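(* Let $c\geq 3$ and let $G_1, G_2, \ldots, G_c$ be oriented graphs on a common set of $n$ vertices. If $e(G_i) > \frac{1}{3}n^2$ for every $i \in \{1,\ldots,c\}$, then there exists a rainbow transitive triangle.
   Context: A directed graph $G$ consists of a vertex set $V(G)$ and an edge set $E(G)$ of ordered pairs of distinct vertices (no loops, no multiple edges). An oriented graph is a directed graph with no pair of vertices $u,v$ such that both $(u,v)$ and $(v,u)$ are edges. $e(G)=|E(G)|$. The edges of $G_i$ are thought of as having color $i$. A rainbow transitive triangle is a triple of distinct vertices $u,v,w$ together with pairwise distinct colors $a,b,d$ such that $(u,v)\in E(G_a)$, $(v,w)\in E(G_b)$, $(u,w)\in E(G_d)$. *)

(* Defs.v *)
From mathcomp Require Import all_boot all_order all_algebra.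

Set Implicit Arguments.
Unset Strict Implicit.
Unset Printing Implicit Defensive.

(* A directed graph on V is given by its edge set, a set of ordered pairs; being
   a set it has no multiple edges. *)
Definition loopless (V : finType) (E : {set V * V}) : Prop :=
  forall u : V, (u, u) \notin E.

Definition oriented (V : finType) (E : {set V * V}) : Prop :=
  loopless E /\ forall u v : V, ~ ((u, v) \in E /\ (v, u) \in E).

Definition rainbow_transitive_triangle (V : finType) (c : nat)
    (G : 'I_c -> {set V * V}) (u v w : V) (a b d : 'I_c) : Prop :=
  [/\ [/\ u <> v, v <> w & u <> w],
      [/\ a <> b, b <> d & a <> d]
    & [/\ (u, v) \in G a, (v, w) \in G b & (u, w) \in G d]].

(* Main.v *)
Require Import Defs.
From mathcomp Require Import all_boot all_order all_algebra.
From mathcomp Require Import zify lra.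

(** Suppose there is no rainbow transitive triangle in three of the colours.
    Then these colours have at most [|S|^2] edges in total inside any vertex set
    [S], by induction on [|S|]. If every pair carries at most two colours this is
    clear. Otherwise let [uv] carry all three. If every other vertex sends at
    most 4 edges to [{u, v}], delete [u] and [v]. If some [w] sends at least 5,
    then the edges on [uv] all have the same direction, and [u], [v], [w] contain
    two consecutive three-coloured arcs; in that case every other vertex sends at
    most 6 edges to [{u, v, w}], and these three vertices are deleted. *)

Section RainbowFree.

Variables (C V : finType) (p : C -> rel V).
Hypothesis card_C : #|C| = 3.
Hypothesis p_asym : forall i x y, p i x y -> p i y x -> False.
Hypothesis rainbow_free : forall a b d x y z,
  a != b -> b != d -> a != d -> p a x y -> p b y z -> p d x z -> False.

Implicit Types (a b d i t : C) (A B D : {set C}) (u v w x y z : V).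

Let colors x y := [set i | p i x y || p i y x].
Let mult x y := #|[set i | p i x y]|.

(** * Choosing among three colours *)

Lemma third_color a b : exists d, d != a /\ d != b.
Proof.
have : 0 < #|~: [set a; b]|.
  by have := cardsC [set a; b]; rewrite cards2 card_C; case: (a != b) => /=; lia.
by case/card_gt0P=> d; rewrite !inE negb_or => /andP[]; exists d.
Qed.

Lemma other_color A a : 1 < #|A| -> exists2 b, b \in A & b != a.
Proof.
move=> A_gt1; have : 0 < #|A :\ a| by have := cardsD1 a A; lia.
by case/card_gt0P=> b; rewrite !inE => /andP[]; exists b.
Qed.

Lemma card_colors A : #|A| <= 3.
Proof. by rewrite -card_C max_card. Qed.

Lemma all_colors A : 3 <= #|A| -> forall i, i \in A.
Proof.
move=> A_ge3 i; suff -> : A = setT by rewrite inE.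
by apply/eqP; rewrite eqEcard subsetT cardsT card_C.
Qed.

Lemma card_colorsE x y : #|colors x y| = mult x y + mult y x.
Proof.
rewrite /mult -cardsUI.
have -> : [set i | p i x y] :&: [set i | p i y x] = set0.
  apply/setP=> i; rewrite !inE; apply/negP=> /andP[xy yx].
  exact: p_asym xy yx.
rewrite cards0 addn0; by apply: eq_card => i; rewrite !inE.
Qed.

Lemma mult_loop x : mult x x = 0.
Proof.
by apply: eq_card0 => i; rewrite inE; apply/negP => xx; apply: (p_asym _ _ _ xx).
Qed.

(** * A vertex facing a pair that carries all three colours *)

(** The third colour is present on the arc from [u] to [v], and three of the four orientations of
    the edges at [x] form a transitive triangle with it. Only the cyclic triangle x -> u -> v -> x
    survives. *)
Lemma arc_full_cyclic u v x a b :
    (forall i, p i u v) -> a != b -> a \in colors x u -> b \in colors x v ->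
  p a x u /\ p b v x.
Proof.
move=> uv ab; have [d [da db]] := third_color a b.
rewrite !inE => /orP[xu|ux] /orP[xv|vx]; split => //; exfalso.
- by apply: (@rainbow_free a d b x u v); rewrite // eq_sym.
- by apply: (@rainbow_free a b d u x v); rewrite // eq_sym.
- by apply: (@rainbow_free a b d u x v); rewrite // eq_sym.
- by apply: (@rainbow_free d b a u v x); rewrite // eq_sym.
Qed.

(** A colour [a] on [xu] points to [u] if some other colour lies on [xv], because [uv] is full; it
    points to [x] if some other colour lies on [xw], because [wu] is full. Seven edges at [x]
    provide one [a] with both properties. *)
Lemma arc_full_path u v w x :
    (forall i, p i w u) -> (forall i, p i u v) ->
  #|colors x u| + #|colors x v| + #|colors x w| <= 6.
Proof.
move=> wu uv; rewrite leqNgt; apply/negP.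
have contra a b d : a \in colors x u -> b \in colors x v -> d \in colors x w ->
    b != a -> d != a -> False.
  move=> xu xv xw ba da.
  have [xu' _] : p a x u /\ p b v x by apply: arc_full_cyclic; rewrite // eq_sym.
  have [_ ux] := arc_full_cyclic w u x d a wu da xw xu.
  exact: p_asym xu' ux.
have hu := card_colors (colors x u); have hv := card_colors (colors x v).
have hw := card_colors (colors x w) => gt6.
(* Seven edges, at most three per pair, leave no pair empty. If [xv] or [xw] has a single colour,
   the other two pairs have all three, so that colour is chosen first and the others avoid it. *)
have [v_gt1|v_le1] := ltnP 1 #|colors x v|.
  have [w_gt1|w_le1] := ltnP 1 #|colors x w|.
    have /card_gt0P[a xu] : 0 < #|colors x u| by lia.
    have [b xv ba] := other_color _ a v_gt1.
    have [d xw da] := other_color _ a w_gt1.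
    exact: contra xu xv xw ba da.
  have /card_gt0P[d xw] : 0 < #|colors x w| by lia.
  have [|a xu ad] := other_color (colors x u) d; first by lia.
  have [b xv ba] := other_color _ a v_gt1.
  by apply: contra xu xv xw ba _; rewrite eq_sym.
have /card_gt0P[b xv] : 0 < #|colors x v| by lia.
have [|a xu ab] := other_color (colors x u) b; first by lia.
have [|d xw da] := other_color (colors x w) a; first by lia.
by apply: contra xu xv xw _ da; rewrite eq_sym.
Qed.

Lemma five_colors x u v : 4 < #|colors x u| + #|colors x v| ->
     (forall i, i \in colors x u) /\ 1 < #|colors x v|
  \/ 1 < #|colors x u| /\ (forall i, i \in colors x v).
Proof.
have hu := card_colors (colors x u); have hv := card_colors (colors x v) => gt4.
have [u3|u3] := leqP 3 #|colors x u|; [left|right]; split; try lia;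
  apply: all_colors; lia.
Qed.

(** Five edges would provide a colour at [x] whose triangle can be completed on [uv] both by [t] and
    by a colour running against [t]; the two completions force opposite directions on it. *)
Lemma mixed_le4 u v x t :
    p t v u -> (forall i, i != t -> p i u v) ->
  #|colors x u| + #|colors x v| <= 4.
Proof.
move=> vu uv; rewrite leqNgt; apply/negP.
(* The colour [d] that remains lies on [uv], and its direction there decides which of the two cyclic
   triangles [x], [u], [v] must form. *)
have direction a b d : a != b -> d != a -> d != b ->
    a \in colors x u -> b \in colors x v ->
  if d == t then p a u x /\ p b x v else p a x u /\ p b v x.
  move=> ab da db; have [dt|dt] := eqVneq d t.
    have ua : p a u v by apply: uv; rewrite -dt eq_sym.
    have ub : p b u v by apply: uv; rewrite -dt eq_sym.
    rewrite -dt in vu.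
    rewrite !inE => /orP[xu|ux] /orP[xv|vx]; split => //; exfalso.
    all: try by apply: (@rainbow_free b d a x v u); rewrite // eq_sym.
    all: try by apply: (@rainbow_free b a d v x u); rewrite // eq_sym.
    all: try by apply: (@rainbow_free d a b v u x); rewrite // eq_sym.
  have {}uv := uv d dt.
  rewrite !inE => /orP[xu|ux] /orP[xv|vx]; split => //; exfalso.
  all: try by apply: (@rainbow_free a d b x u v); rewrite // eq_sym.
  all: try by apply: (@rainbow_free a b d u x v); rewrite // eq_sym.
  all: try by apply: (@rainbow_free d b a u v x); rewrite // eq_sym.
case/five_colors=> [[xu /other_color gt1] | [/other_color gt1 xv]].
  (* The colour [b] is combined once with [t] on [xu], leaving [d] for [uv], and once with [d],
     leaving [t]. *)
  have [b xv bt] := gt1 t; have [d [db dt]] := third_color b t.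
  have := direction t b d; have := direction d b t.
  rewrite eqxx (negPf dt) ![t == _]eq_sym ![b == _]eq_sym => P Q.
  have [_ xvb] : p d u x /\ p b x v by apply: P; rewrite ?xu // eq_sym.
  have [_ vxb] : p t x u /\ p b v x by apply: Q; rewrite ?xu // eq_sym.
  exact: p_asym xvb vxb.
have [a xu at_] := gt1 t; have [d [da dt]] := third_color a t.
have := direction a t d; have := direction a d t.
rewrite eqxx (negPf dt) ![t == _]eq_sym => P Q.
have [uxa _] : p a u x /\ p d x v by apply: P; rewrite ?xv // eq_sym.
have [xua _] : p a x u /\ p t v x by apply: Q; rewrite ?xv // eq_sym.
exact: p_asym xua uxa.
Qed.

(** When three colours do not all agree in direction, exactly one runs against the other two, which
    is the situation of [mixed_le4]. *)
Lemma full_direction u v : (forall i, i \in colors u v) ->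
  [\/ forall i, p i u v, forall i, p i v u
    | forall x, #|colors x u| + #|colors x v| <= 4].
Proof.
move=> full; pose A := [set i | p i u v].
have backward i : i \notin A -> p i v u.
  by have := full i; rewrite !inE => /orP[->|].
have hA := card_colors A; have hAC := cardsC A; rewrite card_C in hAC.
have [A3|A_lt3] := leqP 3 #|A|.
  by apply: Or31 => i; have := all_colors A A3 i; rewrite inE.
have [/cards1P[t At]|A1] := boolP (#|A| == 1).
  apply: Or33 => x; rewrite addnC; apply: (@mixed_le4 v u x t).
    by have := set11 t; rewrite -At inE.
  by move=> i it; apply: backward; rewrite At inE.
have [/cards1P[t At]|A2] := boolP (#|~: A| == 1).
  apply: Or33 => x; apply: (@mixed_le4 u v x t).
    by apply: backward; rewrite -in_setC At set11.
  move=> i it; have : i \notin ~: A by rewrite At inE.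
  by rewrite !inE negbK.
by apply: Or32 => i; apply: backward; have := all_colors (~: A);
  rewrite -in_setC; apply; lia.
Qed.

(** One of [wu], [wv] is full, and each of its colours differs from some colour on the other, so
    [arc_full_cyclic] fixes its direction. *)
Lemma arc_full_extend u v w : (forall i, p i u v) ->
    4 < #|colors w u| + #|colors w v| ->
  (forall i, p i w u) \/ (forall i, p i v w).
Proof.
move=> uv /five_colors[[wu /other_color gt1]|[/other_color gt1 wv]].
  left=> i; have [b wv bi] := gt1 i.
  by have [] : p i w u /\ p b v w by apply: arc_full_cyclic; rewrite // eq_sym.
right=> i; have [a wu ai] := gt1 i.
by have [] : p a w u /\ p i v w by apply: arc_full_cyclic.
Qed.

(** * Counting edges by deleting vertices *)

Let inner (S : {set V}) := \sum_(x in S) \sum_(y in S) mult x y.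

(** The allowance [2 * #|T|] per remaining vertex is exactly the cross term in the square of
    [#|S :\: T| + #|T|]. *)
Lemma inner_delete (S T : {set V}) : T \subset S ->
    inner (S :\: T) <= #|S :\: T| ^ 2 -> inner T <= #|T| ^ 2 ->
    (forall x, x \in S :\: T -> \sum_(y in T) #|colors x y| <= 2 * #|T|) ->
  inner S <= #|S| ^ 2.
Proof.
move=> TS innerD innerT cross.
have split_sum (F : V -> nat) :
    \sum_(x in S) F x = \sum_(x in T) F x + \sum_(x in S :\: T) F x.
  by rewrite (big_setID T) /= (setIidPr TS).
(* Edges between [T] and its complement occur in both directions, and the two directions together
   are counted by [colors]. *)
have -> : inner S = inner T + inner (S :\: T)
    + \sum_(x in S :\: T) \sum_(y in T) #|colors x y|.
  rewrite /inner split_sum.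
  under eq_bigr do rewrite split_sum.
  under [X in _ + X]eq_bigr do rewrite split_sum.
  rewrite !big_split /= [X in _ + X + _]exchange_big /=.
  under [X in _ = _ + X]eq_bigr do
    (under eq_bigr do rewrite card_colorsE; rewrite big_split /=).
  rewrite big_split /=; lia.
have cardS := cardsID T S; rewrite (setIidPr TS) in cardS.
have : \sum_(x in S :\: T) \sum_(y in T) #|colors x y|
    <= #|S :\: T| * (2 * #|T|).
  by rewrite -sum_nat_const; apply: leq_sum.
by rewrite -cardS sqrnD; lia.
Qed.

Lemma sum_set2 u v (F : V -> nat) : u != v ->
  \sum_(x in [set u; v]) F x = F u + F v.
Proof. by move=> uv; rewrite big_setU1 ?inE //= big_set1. Qed.

Lemma sum_set3 u v w (F : V -> nat) : w != u -> w != v -> u != v ->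
  \sum_(x in w |: [set u; v]) F x = F w + (F u + F v).
Proof.
move=> wu wv uv; rewrite big_setU1 ?sum_set2 //.
by rewrite !inE negb_or wu.
Qed.

Lemma inner_le_sqr (S : {set V}) : inner S <= #|S| ^ 2.
Proof.
have [n] := ubnP #|S|; elim: n S => // n IHn S /ltnSE cardS.
have IH (T : {set V}) u : T \subset S -> u \in T ->
    inner (S :\: T) <= #|S :\: T| ^ 2.
  move=> TS uT; apply: IHn.
  have := cardsID T S; rewrite (setIidPr TS).
  have : 0 < #|T| by apply/card_gt0P; exists u.
  lia.
have [/exists_inP[u uS /exists_inP[v vS uv3]]|no_full] :=
    boolP [exists u in S, exists v in S, 3 <= #|colors u v|]; last first.
  (* Exchanging the sums in one copy pairs [mult x y] with [mult y x]; together they are at most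
     2. *)
  have : inner S + inner S <= \sum_(x in S) \sum_(y in S) 2.
    rewrite {2}/inner exchange_big -big_split /=; apply: leq_sum => x xS.
    rewrite -big_split /=; apply: leq_sum => y yS.
    rewrite -card_colorsE leqNgt; apply: contra no_full => xy.
    by apply/exists_inP; exists x => //; apply/exists_inP; exists y.
  by rewrite !sum_nat_const -mulnn; lia.
have uv : u != v.
  by apply: contraTneq uv3 => ->; rewrite card_colorsE !mult_loop.
have delete2 : (forall x, x \in S -> #|colors x u| + #|colors x v| <= 4) ->
    inner S <= #|S| ^ 2.
  move=> le4; have TS : [set u; v] \subset S by rewrite subUset !sub1set uS.
  apply: (inner_delete _ _ TS).
  - by apply: (IH _ u TS); rewrite !inE eqxx.
  - rewrite /inner !sum_set2 // !mult_loop cards2 uv.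
    by have := card_colors (colors u v); rewrite card_colorsE; lia.
  - move=> x; rewrite inE => /andP[_ xS].
    by rewrite sum_set2 // cards2 uv le4.
have directed y z : y \in S -> z \in S -> y != z -> (forall i, p i y z) ->
    (forall x, x \in S -> #|colors x y| + #|colors x z| <= 4) \/
    inner S <= #|S| ^ 2.
  move=> yS zS yz full.
  have [le4|] := boolP [forall x in S, #|colors x y| + #|colors x z| <= 4].
    by left=> x xS; have /forall_inP := le4; apply.
  rewrite negb_forall_in => /exists_inP[w wS]; rewrite -ltnNge => w5; right.
  (* If [w] were an end of the arc, one of its two pairs would be a loop, leaving at most three
     edges. *)
  have wy : w != y.
    apply: contraTneq w5 => ->; rewrite [#|colors y y|]card_colorsE !mult_loop.
    by have := card_colors (colors y z); lia.
  have wz : w != z.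
    apply: contraTneq w5 => ->; rewrite [#|colors z z|]card_colorsE !mult_loop.
    by have := card_colors (colors z y); lia.
  have le6 x : #|colors x w| + (#|colors x y| + #|colors x z|) <= 6.
    have [wyF|zwF] := arc_full_extend _ _ _ full w5.
      by have := arc_full_path y z w x wyF full; lia.
    by have := arc_full_path z w y x full zwF; lia.
  have TS : w |: [set y; z] \subset S by rewrite !subUset !sub1set wS yS.
  have cardT : #|w |: [set y; z]| = 3.
    by rewrite cardsU1 cards2 yz !inE negb_or wy wz.
  apply: (inner_delete _ _ TS); rewrite ?cardT.
  - by apply: (IH _ y TS); rewrite !inE eqxx orbT.
  (* Three pairs with at most three edges each just meet the bound 3^2. *)
  - rewrite /inner !sum_set3 // !mult_loop.
    have := card_colors (colors w y); have := card_colors (colors w z).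
    by have := card_colors (colors y z); rewrite !card_colorsE; lia.
  - by move=> x _; rewrite sum_set3.
have [F|F|le4] := full_direction _ _ (all_colors _ uv3).
- by case: (directed u v).
- case: (directed v u) => //; first by rewrite eq_sym.
  by move=> le4; apply: delete2 => x xS; rewrite addnC le4.
- exact: delete2.
Qed.

Lemma sum_card_arcs_le :
  \sum_i #|[set e : V * V | p i e.1 e.2]| <= #|V| ^ 2.
Proof.
rewrite -cardsT; apply: leq_trans (inner_le_sqr setT).
rewrite /inner /mult.
under eq_bigr do rewrite -sum1dep_card.
rewrite [leqRHS](_ : _ = \sum_x \sum_y \sum_i (p i x y : nat)); last first.
  apply: eq_big => [x|x _]; first by rewrite inE.
  apply: eq_big => [y|y _]; first by rewrite inE.
  by rewrite -sum1dep_card big_mkcond.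
rewrite pair_bigA exchange_big /=; apply: leq_sum => i _.
by rewrite big_mkcond.
Qed.

End RainbowFree.

Theorem theorem4 (c n : nat) (hc : (3 <= c)%N) (V : finType) (hV : #|V| = n)
    (G : 'I_c -> {set V * V}) (hG : forall i : 'I_c, oriented (G i))
    (he : forall i : 'I_c, (1 / 3 * n%:R ^+ 2 < (#|G i|)%:R :> rat)%R) :
  exists (u v w : V) (a b d : 'I_c),
    rainbow_transitive_triangle G u v w a b d.
Proof.
(* Any three colours suffice; the first three are kept. *)
pose col (i : 'I_3) := widen_ord hc i.
have col_inj (i j : 'I_3) : i != j -> col i <> col j.
  by move=> /eqP ij [] /val_inj.
have dist i u v : (u, v) \in G i -> u <> v.
  by move=> uv E; have [/(_ u)] := hG i; rewrite E -{1}E uv.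
pose p (i : 'I_3) : rel V := fun x y => (x, y) \in G (col i).
have [/existsP[a /existsP[b /existsP[d]]]|none] := boolP [exists a, exists b,
    exists d, [exists x, exists y, exists z,
    [&& a != b, b != d, a != d, p a x y, p b y z & p d x z]]].
  case/existsP=> x /existsP[y /existsP[z]].
  case/and5P=> ab bd ad xy /andP[yz xz].
  exists x, y, z, (col a), (col b), (col d); split; split => //.
  1-6: by [exact: col_inj | exact: (dist _ _ _ xy) | exact: (dist _ _ _ yz) | exact: (dist _ _ _ xz)].
have gt i : n ^ 2 < 3 * #|G i|.
  have := he i; rewrite -(Num.Theory.ltr_nat rat) GRing.natrM GRing.natrX; lra.
have : \sum_i #|[set e : V * V | p i e.1 e.2]| <= #|V| ^ 2.
  apply: sum_card_arcs_le; first by rewrite card_ord.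
  - by move=> i x y xy yx; have [_ /(_ x y)] := hG (col i); apply.
  - move=> a b d x y z ab bd ad xy yz xz; case/negP: none.
    apply/existsP; exists a; apply/existsP; exists b; apply/existsP; exists d.
    apply/existsP; exists x; apply/existsP; exists y; apply/existsP; exists z.
    by rewrite ab bd ad xy yz xz.
have GE i : #|[set e : V * V | p i e.1 e.2]| = #|G (col i)|.
  by apply: eq_card => -[x y]; rewrite !inE.
rewrite hV; under eq_bigr do rewrite GE.
rewrite !big_ord_recl big_ord0.
(* Three graphs with more than n^2 / 3 edges each exceed the rainbow-free bound n^2. *)
have := gt (col ord0); have := gt (col (lift ord0 ord0)).
have := gt (col (lift ord0 (lift ord0 ord0))); lia.
Qed.
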